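(* Let $n\ge1$ and let $r,s,\alpha,\gamma\in\mathbf{R}$ with $s>r>0$. Suppose $b\in CMO$ and that $f$ is a locally bounded measurable function on $\mathbf{R}^n$ with $f\in L^r_{loc}(\mathbf{R}^n,|x|^{n(\alpha-1)})$. When $\alpha\neq1$ and $\gamma\ne s/r$, put $$c_2=\frac{1}{|1-\gamma r/s|^{s/r}}\Big[2^{n|\alpha|}\,2^{n|\alpha-1|}\,3^{r}\cdot 4\cdot 2^{2nr}\sum_{k=0}^{\infty}2^{-kn|\alpha-1|}k^{r}\Big]^{s/r}.$$ (i) If $\alpha>1$ and $\gamma<s/r$, then $$\int_{\mathbf{R}^n}|B(|y|)|^{\gamma-1}\big(M_{r,b}(f,\alpha)(y)\big)^s\,dy\le c_2\,\|b\|_{CMO}^s\int_{\mathbf{R}^n}|B(|y|)|^{\gamma-1}|f(y)|^s\,dy .$$ (ii) If $\alpha<1$ and $\gamma>s/r$, then $$\int_{\mathbf{R}^n}|B(|y|)|^{\gamma-1}\big(M^*_{r,b}(f,\alpha)(y)\big)^s\,dy\le c_2\,\|b\|_{CMO}^s\int_{\mathbf{R}^n}|B(|y|)|^{\gamma-1}|f(y)|^s\,dy .$$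
   Context: For $R>0$, $B(R)$ is the ball in $\mathbf{R}^n$ centered at the origin with radius $R$, and $|E|$ denotes the Lebesgue measure of a set $E$. The condition $f\in L^r_{loc}(\mathbf{R}^n,|x|^{n(\alpha-1)})$ means $\int_K|f(x)|^r|x|^{n(\alpha-1)}dx<\infty$ for every compact $K\subset\mathbf{R}^n$. The space $CMO$: for $1\le p<\infty$ and a locally integrable function $b$ on $\mathbf{R}^n$, let $$\|b\|_{CMO^p}=\sup_{B}\left(\frac1{|B|}\int_B|b(x)-b_B|^p\,dx\right)^{1/p},\qquad b_B=\frac1{|B|}\int_B b(x)\,dx,$$ the supremum being over all balls $B\subset\mathbf{R}^n$ centered at the origin. Then $b\in CMO$ means $\|b\|_{CMO}:=\sup_{1\le p<\infty}\|b\|_{CMO^p}<\infty$. Commutators: for $y\ne0$, $$M_{r,b}(f,\alpha)(y)=\left[\frac{1}{|B(|y|)|^{\alpha}}\int_{B(|y|)}|B(|x|)|^{\alpha-1}\big(|b(x)-b(y)|\,|f(x)|\big)^r\,dx\right]^{1/r},$$ $$M^*_{r,b}(f,\alpha)(y)=\left[\frac{1}{|B(|y|)|^{\alpha}}\int_{\mathbf{R}^n\setminus B(|y|)}|B(|x|)|^{\alpha-1}\big(|b(x)-b(y)|\,|f(x)|\big)^r\,dx\right]^{1/r}.$$ All quantities take values in $[0,\infty]$ and the inequalities are understood in $[0,\infty]$. *)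

(* Defs.v *)
From HB Require Import structures.
From mathcomp Require Import all_boot all_order all_algebra.
From mathcomp Require Import all_classical all_reals all_analysis.

Set Implicit Arguments.
Unset Strict Implicit.
Unset Printing Implicit Defensive.
Import Order.TTheory GRing.Theory Num.Theory.
Import numFieldNormedType.Exports.

Local Open Scope classical_set_scope.
Local Open Scope ring_scope.
Local Open Scope ereal_scope.

Section lebesgue_Rn.
Context (R : realType) (n : nat).
Implicit Types (a b : 'rV[R]_n) (A : set 'rV[R]_n).

Definition box a b : set 'rV[R]_n :=
  [set x | forall i, (a ord0 i < x ord0 i <= b ord0 i)%R].

Definition box_vol a b : R := (\prod_(i < n) Num.max 0 (b ord0 i - a ord0 i))%R.

(* n-dimensional Lebesgue outer measure. The covers are indexed by arbitrary
   subsets D of nat (rather than by nat itself) so that the empty set has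
   measure 0 also when n = 0, where no box is empty. *)
Definition lebesgue_outer A : \bar R :=
  ereal_inf [set m | exists D : set nat, exists a b : nat -> 'rV[R]_n,
    A `<=` \bigcup_(k in D) box (a k) (b k) /\
    m = \esum_(k in D) (box_vol (a k) (b k))%:E].

Lemma box_vol_ge0 a b : (0 <= box_vol a b)%R.
Proof. by apply: prodr_ge0 => i _; rewrite le_max lexx. Qed.

Lemma lebesgue_outer_ge0 A : 0 <= lebesgue_outer A.
Proof.
apply: le_ereal_inf_tmp => _ [D [a [b [_ ->]]]].
by apply: esum_ge0 => k _; rewrite lee_fin box_vol_ge0.
Qed.

Lemma lebesgue_outer0 : lebesgue_outer set0 = 0.
Proof.
apply/eqP; rewrite eq_le lebesgue_outer_ge0 andbT.
apply: ereal_inf_lbound; exists set0, (fun=> 0%R), (fun=> 0%R); split.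
  by move=> x.
by rewrite esum_set0.
Qed.

Lemma le_lebesgue_outer :
  {homo lebesgue_outer : A B / A `<=` B >-> A <= B}.
Proof.
move=> A B AB; apply/ereal_inf_le_tmp => _ [D [a [b [BD ->]]]].
by exists D, a, b; split => //; apply: subset_trans BD.
Qed.

Lemma lebesgue_outer_sigma_subadditive : sigma_subadditive lebesgue_outer.
Proof.
move=> A; have [[i ioo]|] := pselect (exists i, lebesgue_outer (A i) = +oo).
  rewrite (eseries_pinfty _ _ ioo) ?leey// => j _.
  by rewrite -ltNye (lt_le_trans _ (lebesgue_outer_ge0 _)).
rewrite -forallNE => Aoo.
apply/lee_addgt0Pr => _/posnumP[e].
apply: (le_trans _ (epsilon_trick _ _ _)) => //; last first.
  by move=> k; exact: lebesgue_outer_ge0.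
pose P k (c : set nat * (nat -> 'rV[R]_n) * (nat -> 'rV[R]_n)) :=
  A k `<=` \bigcup_(j in c.1.1) box (c.1.2 j) (c.2 j) /\
  \esum_(j in c.1.1) (box_vol (c.1.2 j) (c.2 j))%:E <=
    lebesgue_outer (A k) + (e%:num / (2 ^ k.+1)%:R)%:E.
have [G PG] : {G & forall k, P k (G k)}.
  apply: (@choice _ _ P) => k.
  have fk : lebesgue_outer (A k) \is a fin_num.
    by rewrite ge0_fin_numE ?lebesgue_outer_ge0// ltey; apply/eqP.
  have ek : (0 < e%:num / (2 ^ k.+1)%:R)%R by [].
  have [_ [D [a [b [AD ->]]]] h] := lb_ereal_inf_adherent ek fk.
  by exists (D, a, b); split => //=; exact/ltW.
have /card_esym/ppcard_eqP[f] := card_nat2.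
pose v (p : nat * nat) := (box_vol ((G p.1).1.2 p.2) ((G p.1).2 p.2))%:E.
pose E := [set: nat] `*`` (fun k => (G k).1.1).
have v0 p : 0 <= v p by rewrite lee_fin box_vol_ge0.
apply: (@le_trans _ _ (\esum_(p in E) v p)).
  apply: ereal_inf_lbound; exists (f @^-1` E).
  exists (fun j => (G (f j).1).1.2 (f j).2), (fun j => (G (f j).1).2 (f j).2).
  split.
    move=> x [k _] /(PG k).1 [j Dj xj].
    by exists (f^-1%FUN (k, j)) => /=; rewrite invK ?inE.
  have := @reindex_esum R _ _ (f @^-1` E) E f v; apply => //.
  split.
  - by move=> j.
  - by move=> i j _ _; apply: inj; rewrite inE.
  - by move=> p Ep; exists (f^-1%FUN p) => /=; rewrite invK ?inE.
rewrite /E -(@esum_esum _ _ _ setT (fun k => (G k).1.1) (fun k j => v (k, j)))//.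
rewrite -nneseries_esumT//; last first.
  by move=> k; apply: esum_ge0 => j _; exact: v0.
apply: lee_nneseries => k _; first by move=> _; apply: esum_ge0 => j _; exact: v0.
exact: (PG k).2.
Qed.

HB.instance Definition _ := isOuterMeasure.Build R 'rV[R]_n lebesgue_outer
  lebesgue_outer0 lebesgue_outer_ge0 le_lebesgue_outer
  lebesgue_outer_sigma_subadditive.

End lebesgue_Rn.

(* R^n with the sigma-algebra of Lebesgue measurable sets *)
Notation Rn R n := (caratheodory_type (@lebesgue_outer R n)).

Definition lebesgue_Rn (R : realType) (n : nat) : set (Rn R n) -> \bar R :=
  @lebesgue_outer R n.

HB.instance Definition _ (R : realType) (n : nat) :=
  isMeasure.Build _ _ _ (@lebesgue_Rn R n)
    (@caratheodory_measure0 R 'rV[R]_n (@lebesgue_outer R n))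
    (@caratheodory_measure_ge0 R 'rV[R]_n (@lebesgue_outer R n))
    (@caratheodory_measure_sigma_additive R 'rV[R]_n (@lebesgue_outer R n)).

Section spaces_and_operators.
Context (R : realType) (n : nat).
Implicit Types (b f : 'rV[R]_n -> R) (x y : 'rV[R]_n).
Local Notation mu := (@lebesgue_Rn R n).

(* Euclidean norm; the library norm on 'rV[R]_n is the sup norm. *)
Definition enorm x : R := Num.sqrt (\sum_(i < n) x ord0 i ^+ 2)%R.

Definition ball0 (rho : R) : set (Rn R n) := [set x | (enorm x < rho)%R].

(* |B(rho)| as a real number; balls have finite measure *)
Definition ball0_vol (rho : R) : R := fine (mu (ball0 rho)).

Definition lebesgue_measurable_fun f := measurable_fun [set: Rn R n] f.

Definition locally_bounded f := forall x, bounded_near f (nbhs x).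

(* f in L^r_loc(R^n, |x|^(n(alpha-1))), without the measurability of f *)
Definition loc_power_integrable (r alpha : R) f :=
  forall K : set 'rV[R]_n, compact K ->
    \int[mu]_(x in (K : set (Rn R n)))
      (`|f x| `^ r * enorm x `^ (n%:R * (alpha - 1)))%:E < +oo.

Definition locally_integrable_Rn b :=
  lebesgue_measurable_fun b /\
  forall K : set 'rV[R]_n, compact K ->
    \int[mu]_(x in (K : set (Rn R n))) (`|b x|)%:E < +oo.

Definition ball0_mean b (rho : R) : R :=
  ((ball0_vol rho)^-1 * \int[mu]_(x in ball0 rho) b x)%R.

Definition CMO_pnorm (p : R) b : \bar R :=
  ereal_sup [set ((ball0_vol rho)^-1%:E *
      \int[mu]_(x in ball0 rho) (`|b x - ball0_mean b rho| `^ p)%:E) `^ p^-1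
    | rho in [set rho : R | (0 < rho)%R]].

Definition CMO_norm b : \bar R :=
  ereal_sup [set CMO_pnorm p b | p in [set p : R | (1 <= p)%R]].

Definition CMO b := locally_integrable_Rn b /\ CMO_norm b < +oo.

(* A real power of |B(|x|)| or |x| at x = 0 takes the value given by the
   convention of powR (0 for a nonzero exponent); only the null set {0} is
   concerned. In particular the values of the operators at y = 0 are
   immaterial. *)
Definition Mcomm (r : R) b f (alpha : R) y : \bar R :=
  ((ball0_vol (enorm y) `^ alpha)^-1%:E *
   \int[mu]_(x in ball0 (enorm y))
     (ball0_vol (enorm x) `^ (alpha - 1) * (`|b x - b y| * `|f x|) `^ r)%:E)
  `^ r^-1.

Definition Mcomm_dual (r : R) b f (alpha : R) y : \bar R :=
  ((ball0_vol (enorm y) `^ alpha)^-1%:E *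
   \int[mu]_(x in ~` ball0 (enorm y))
     (ball0_vol (enorm x) `^ (alpha - 1) * (`|b x - b y| * `|f x|) `^ r)%:E)
  `^ r^-1.

Definition c2 (r s alpha gamma : R) : \bar R :=
  ((`|1 - gamma * r / s| `^ (s / r))^-1)%:E *
  ((2 `^ (n%:R * `|alpha|) * 2 `^ (n%:R * `|alpha - 1|) * 3 `^ r * 4 *
    2 `^ (2 * n%:R * r))%:E *
   \sum_(0 <= k <oo)
     (2 `^ (- (k%:R * n%:R * `|alpha - 1|)) * k%:R `^ r)%:E) `^ (s / r).

End spaces_and_operators.

(* Main.v *)
(* The CMO norm is a supremum over all exponents p, so it is an essential
   bound: by Chebyshev, |b - b_B| <= ||b|| almost everywhere on every ball B
   centred at the origin, hence |b x - b y| <= 2 ||b|| for almost all x, y.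
   What remains is a weighted Hardy inequality for |f|^r with exponent
   p = s / r, proved by the Schur test with powers of w x = |B(|x|)| as test
   functions.  With theta = alpha - gamma / p it needs only the integrals of
   w^(theta - 1) and w^(- theta - 1) over balls and their complements.  They
   are bounded, up to a factor 4, by telescoping over thin shells, and this
   factor is absorbed by c2, since |theta| >= |1 - gamma / p| in both cases. *)
From HB Require Import structures.
Require Import Defs.
From mathcomp Require Import all_boot all_order all_algebra.
From mathcomp Require Import all_classical all_reals all_analysis.
From mathcomp Require Import measurable_realfun ring lra.
Import Order.TTheory GRing.Theory Num.Theory.
Import numFieldNormedType.Exports.
Local Open Scope classical_set_scope.
Local Open Scope ring_scope.
Local Open Scope ereal_scope.
Set Implicit Arguments.
Unset Strict Implicit.
Unset Printing Implicit Defensive.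

(** When [V 1 > 0], the function [w] carries Lebesgue measure to length on the half-line, so the
    power integrals of the Schur test behave as in dimension one. No polar coordinates enter.
    Volumes are known only through the homogeneity [mu (B rho) = rho ^+ n * V 1] with [V 1] finite,
    which comes from scaling covers by boxes. Thin shells then give the integrals up to a constant
    factor, and the generous numerical factors of [c2] pay for the loss. Positivity of [V 1] is
    never derived: if [V 1 = 0] the whole space is null and both inequalities are trivial, so the
    estimates may assume [V 1 > 0]. A second obstacle is that the commutators are not shown to be
    measurable in [y]. The integral comparisons are therefore arranged so that the smaller function
    is arbitrary and only the larger one is measurable. *)

(** * Lebesgue measure: measurability of half-spaces, scaling, volumes of centred balls *)

Section lebesgue_Rn_geometry.
Context (R : realType) (n : nat).
Implicit Types (a b x : 'rV[R]_n) (A : set 'rV[R]_n) (rho : R).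
Local Notation mu := (@lebesgue_Rn R n).
Local Notation B := (@Defs.ball0 R n).

Let upper_cut b (i : 'I_n) (c : R) : 'rV[R]_n :=
  \row_j (if j == i then Num.min (b ord0 j) c else b ord0 j)%R.

Let lower_cut a (i : 'I_n) (c : R) : 'rV[R]_n :=
  \row_j (if j == i then Num.max (a ord0 j) c else a ord0 j)%R.

(** Only the [i]-th factor changes, and [max 0 (b - a) = max 0 (min b c - a) + max 0 (b - max a c)]
    holds for all reals. Degenerate boxes and cuts outside the box are thus included. *)
Let box_vol_cut a b i c : box_vol a b =
  (box_vol a (upper_cut b i c) + box_vol (lower_cut a i c) b)%R.
Proof.
have rest (a' b' : 'rV[R]_n) :
    (forall j, j != i -> a' ord0 j = a ord0 j) ->
    (forall j, j != i -> b' ord0 j = b ord0 j) ->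
    box_vol a' b' = (Num.max 0 (b' ord0 i - a' ord0 i) *
      \prod_(j < n | j != i) Num.max 0 (b ord0 j - a ord0 j))%R.
  move=> aa bb; rewrite /box_vol (bigD1 i)//=; congr (_ * _)%R.
  by apply: eq_bigr => j ji; rewrite aa ?bb.
rewrite !rest => [|j /negbTE ji|j ji|j ji|j /negbTE ji|j _|j _]//; rewrite ?mxE ?ji// eqxx.
rewrite -mulrDl; congr (_ * _)%R.
rewrite /Num.max /Num.min.
by case: (ltP (b ord0 i) c) => ?; case: (ltP (a ord0 i) c) => ?; repeat case: ltP => ?; lra.
Qed.

(** Caratheodory's criterion: cutting every box of a cover of [X] along the hyperplane gives covers
    of both parts of [X] with the same total volume. Boxes open on the left and closed on the right
    match the closed half-space and its open complement exactly. *)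
Lemma measurable_halfspace (i : 'I_n) (c : R) :
  measurable ([set x | x ord0 i <= c]%R : set (Rn R n)).
Proof.
apply: (@le_caratheodory_measurable R _ (@lebesgue_outer R n)) => X.
apply: le_ereal_inf_tmp => _ [D [a [b [XD ->]]]].
rewrite (eq_esum (b := fun k => (box_vol (a k) (upper_cut (b k) i c))%:E +
   (box_vol (lower_cut (a k) i c) (b k))%:E)); last first.
  by move=> k _; rewrite -EFinD -box_vol_cut.
rewrite esumD; [|by move=> k _; rewrite lee_fin box_vol_ge0..].
apply: leeD; apply: ereal_inf_lbound.
- exists D, a, (fun k => upper_cut (b k) i c); split => // x [/XD[k Dk xk] xc].
  exists k => // j; have /andP[-> /=] := xk j; rewrite mxE.
  by case: eqP => // ->; rewrite le_min => ->.
- exists D, (fun k => lower_cut (a k) i c), b; split => // x [/XD[k Dk xk]].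
  move=> /negP; rewrite -ltNge => xc.
  exists k => // j; have /andP[+ -> /=] := xk j; rewrite mxE andbT.
  by case: eqP => // ->; rewrite gt_max => ->.
Qed.

Lemma measurable_coord (i : 'I_n) :
  measurable_fun setT (fun x : Rn R n => x ord0 i : R).
Proof.
move=> mT; apply: (measurability _ (RGenOInfty.measurableE R)) => //.
move=> _ [_ [c ->] <-]; rewrite setTI.
rewrite [X in measurable X](_ : _ = ~` [set x : Rn R n | x ord0 i <= c]%R).
  exact/measurableC/measurable_halfspace.
apply/seteqP; split => x /=; rewrite in_itv/= andbT.
  by rewrite ltNge => /negP.
by move=> /negP; rewrite -ltNge.
Qed.

Lemma measurable_enorm : measurable_fun setT (@enorm R n : Rn R n -> R).
Proof.
apply: (measurableT_comp (continuous_measurable_fun (@sqrt_continuous R))).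
apply: measurable_sum => i; apply: measurable_funX; exact: measurable_coord.
Qed.

Lemma enorm_ge0 x : (0 <= enorm x)%R. Proof. exact: sqrtr_ge0. Qed.

Lemma enormZ (c : R) x : enorm (c *: x) = (`|c| * enorm x)%R.
Proof.
rewrite /enorm -sqrtr_sqr -sqrtrM ?sqr_ge0// mulr_sumr.
by congr (Num.sqrt _); apply: eq_bigr => i _; rewrite mxE exprMn.
Qed.

Lemma ler_coord_enorm (i : 'I_n) x : (`|x ord0 i| <= enorm x)%R.
Proof.
rewrite -sqrtr_sqr ler_sqrt ?sumr_ge0// => [|j _]; rewrite ?sqr_ge0//.
by rewrite (bigD1 i)//= lerDl sumr_ge0// => j _; rewrite sqr_ge0.
Qed.

Lemma measurable_ball0 rho : measurable (B rho).
Proof.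
rewrite (_ : B _ = setT `&` (@enorm R n @^-1` `]-oo, rho[)).
  by apply: measurable_enorm => //; exact: measurable_itv.
by rewrite setTI; apply/seteqP; split => x /=; rewrite in_itv.
Qed.

Let le_lebesgue_outerZ (c : R) A : (0 < c)%R ->
  lebesgue_outer [set (c *: x)%R | x in A] <= (c ^+ n)%:E * lebesgue_outer A.
Proof.
move=> c0; have cn0 : (0 < c ^+ n)%R by rewrite exprn_gt0.
rewrite -lee_pdivrMl//; apply: le_ereal_inf_tmp => _ [D [a [b [AD ->]]]].
rewrite lee_pdivrMl//; apply: (@le_trans _ _
  (\esum_(k in D) (box_vol (c *: a k) (c *: b k))%:E)).
  apply: ereal_inf_lbound.
  exists D, (fun k => c *: a k)%R, (fun k => c *: b k)%R; split => //.
  move=> _ [x /AD[k Dk xk] <-]; exists k => // i; rewrite !mxE.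
  by rewrite ltr_pM2l// ler_pM2l// xk.
rewrite (eq_esum (b := fun k => (c ^+ n)%:E * (box_vol (a k) (b k))%:E)); last first.
  move=> k _; rewrite -EFinM; congr EFin; rewrite /box_vol.
  rewrite -[n in (c ^+ n)%R]card_ord -prodr_const -big_split/=.
  by apply: eq_bigr => i _; rewrite !mxE -mulrBr maxr_pMr ?ltW// mulr0.
apply: ge_ereal_sup => _ [X [finX XD] <-].
rewrite -ge0_mule_fsumr; last by move=> k; rewrite lee_fin box_vol_ge0.
rewrite lee_pmul2l ?lte_fin//.
by apply: esum_ge; exists X.
Qed.

(** The reverse inequality is the scaling bound for [c^-1], applied to the dilated set. *)
Lemma lebesgue_outerZ (c : R) A : (0 < c)%R ->
  lebesgue_outer [set (c *: x)%R | x in A] = (c ^+ n)%:E * lebesgue_outer A.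
Proof.
move=> c0; apply/eqP; rewrite eq_le le_lebesgue_outerZ//=.
rewrite -lee_pdivlMl ?exprn_gt0// -exprVn.
apply: le_trans (le_lebesgue_outerZ _ _); last by rewrite invr_gt0.
apply: le_lebesgue_outer => x Ax /=; exists (c *: x)%R; first by exists x.
by rewrite scalerA mulVf ?gt_eqF// scale1r.
Qed.

Lemma ball0Z (c rho : R) : (0 < c)%R ->
  B (c * rho)%R = [set (c *: x)%R | x in B rho].
Proof.
move=> c0; apply/seteqP; split => [x|_ [x + <-]]; rewrite /Defs.ball0/=.
  move=> xc; exists (c^-1 *: x)%R; last by rewrite scalerA mulfV ?gt_eqF// scale1r.
  by rewrite enormZ gtr0_norm ?invr_gt0// ltr_pdivrMl.
by rewrite enormZ gtr0_norm// ltr_pM2l.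
Qed.

Lemma mu_ball0_1_lty : mu (B 1) < +oo.
Proof.
apply: (@le_lt_trans _ _ (\esum_(k in [set 0%N])
    (box_vol (\row_(i < n) -1) (\row_(i < n) 1) : R)%:E)).
  apply: ereal_inf_lbound.
  exists [set 0%N], (fun=> \row_(i < n) -1)%R, (fun=> \row_(i < n) 1)%R; split => //.
  move=> x x1; exists 0%N => // i; rewrite !mxE.
  have := le_lt_trans (ler_coord_enorm i x) x1.
  by rewrite ltr_norml => /andP[-> /ltW].
by rewrite esum_set1 ?ltry// lee_fin box_vol_ge0.
Qed.

Lemma mu_ball0 rho : (0 < rho)%R ->
  mu (B rho) = (rho ^+ n * ball0_vol n 1)%:E.
Proof.
move=> rho0; rewrite EFinM fineK ?ge0_fin_numE ?mu_ball0_1_lty//.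
rewrite -[in LHS](mulr1 rho) ball0Z//; exact: lebesgue_outerZ.
Qed.

Lemma ball0_volE rho : (0 < n)%N -> (0 <= rho)%R ->
  ball0_vol n rho = (rho ^+ n * ball0_vol n 1)%R.
Proof.
move=> n0; rewrite le_eqVlt => /predU1P[<-|rho0]; last first.
  by rewrite {1}/ball0_vol mu_ball0.
(* The ball of radius 0 is empty, whereas [0 ^+ n] vanishes only for positive [n]. *)
rewrite expr0n eqn0Ngt n0 mul0r /ball0_vol.
rewrite (_ : B 0 = set0) ?measure0//.
by apply/seteqP; split => // x; rewrite /Defs.ball0/= ltNge enorm_ge0.
Qed.

Lemma ball0_vol_ge0 rho : (0 <= ball0_vol n rho)%R.
Proof. by rewrite fine_ge0. Qed.

End lebesgue_Rn_geometry.

Lemma ge0_integral_bigcup_le d (T : measurableType d) (R : realType)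
    (mu : {measure set T -> \bar R}) (F : (set T)^nat) (f : T -> \bar R)
    (M : \bar R) :
  {homo F : i j / (i <= j)%N >-> (i <= j)%O} -> (forall k, measurable (F k)) ->
  measurable_fun setT f -> (forall x, 0 <= f x) ->
  (forall k, \int[mu]_(x in F k) f x <= M) ->
  \int[mu]_(x in \bigcup_k F k) f x <= M.
Proof.
move=> ndF mF mf f0 FM.
have cF : \int[mu]_(x in F k) f x @[k --> \oo] --> \int[mu]_(x in \bigcup_k F k) f x.
  by apply: ge0_nondecreasing_set_cvg_integral => // k; exact: measurable_funTS.
rewrite -(cvg_lim _ cF)//; apply: lime_le; first by apply/cvg_ex; eexists; exact: cF.
exact: nearW.
Qed.

(** * Radial functions: null sets, measurability, growth of ball volumes *)

Section radial_powers.
Context (R : realType) (n : nat).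
Context (n_gt0 : (0 < n)%N).
Implicit Types (x : 'rV[R]_n) (rho sigma : R).
Local Notation mu := (@lebesgue_Rn R n).
Local Notation B := (@Defs.ball0 R n).
Local Notation V := (@ball0_vol R n).
Local Notation w := (fun x : Rn R n => V (enorm x)).

Lemma sigma_finite_lebesgue_Rn : sigma_finite setT mu.
Proof.
exists (fun k : nat => B k.+1%:R).
  apply/esym; rewrite -subTset => x _.
  exists (Num.truncn (enorm x)) => //; exact: truncnS_gt.
move=> k; split; first exact: measurable_ball0.
by rewrite mu_ball0// ltry.
Qed.

(** Homogeneity makes every ball null, and countably many balls exhaust the space. This settles the
    degenerate case of the theorem. *)
Lemma lebesgue_Rn_null : V 1 = 0%R -> mu setT = 0.
Proof.
move=> V10; apply/eqP; rewrite -measure_le0.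
rewrite (le_trans (@measure_sigma_subadditive _ _ _ mu _ (fun k => B k.+1%:R) _ _ _))//.
- by move=> k; exact: measurable_ball0.
- move=> x _; exists (Num.truncn (enorm x)) => //; exact: truncnS_gt.
- by rewrite eseries0// => k _ _; rewrite [LHS](@mu_ball0 R n)// V10 mulr0.
Qed.

Lemma measurable_enorm_le rho : measurable ([set x | enorm x <= rho]%R : set (Rn R n)).
Proof.
rewrite [X in measurable X](_ : _ = setT `&` (@enorm R n : Rn R n -> R) @^-1` `]-oo, rho]).
  by apply: measurable_enorm => //; exact: measurable_itv.
by rewrite setTI; apply/seteqP; split => x /=; rewrite in_itv.
Qed.

Lemma measurable_enorm_ge rho : measurable ([set x | rho <= enorm x]%R : set (Rn R n)).
Proof.
rewrite [X in measurable X](_ : _ = setT `&` (@enorm R n : Rn R n -> R) @^-1` `[rho, +oo[).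
  by apply: measurable_enorm => //; exact: measurable_itv.
by rewrite setTI; apply/seteqP; split => x /=; rewrite in_itv/= andbT.
Qed.

Lemma lebesgue_Rn_origin : mu [set x | enorm x <= 0]%R = 0.
Proof.
set Z := [set x | _]; have mZ : measurable (Z : set (Rn R n)) by exact: measurable_enorm_le.
have ZB (rho : R) : (0 < rho)%R -> mu Z <= (rho ^+ n * V 1)%:E.
  move=> rho0; rewrite -mu_ball0//; apply: le_measure; rewrite ?inE//.
    exact: measurable_ball0.
  by move=> x /= x0; rewrite /Defs.ball0/= (le_lt_trans x0).
have : mu Z \is a fin_num.
  by rewrite ge0_fin_numE// (le_lt_trans (ZB 1%R ltr01))// ltry.
move=> /fineK zE; rewrite -zE; congr EFin; apply/eqP; rewrite eq_le fine_ge0// andbT.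
apply/ler_addgt0Pr => eps eps0; rewrite add0r -lee_fin zE.
(* The cap 1 gives [rho ^+ n <= rho]; the summand 1 keeps the divisor positive even if [V 1 = 0]. *)
pose rho := Num.min 1%R (eps / (V 1 + 1))%R.
have V1 : (0 < V 1 + 1)%R by rewrite ltr_wpDl// ball0_vol_ge0.
have rho0 : (0 < rho)%R by rewrite lt_min ltr01/= divr_gt0.
apply: (le_trans (ZB _ rho0)); rewrite lee_fin.
apply: (@le_trans _ _ (rho * V 1)%R).
  rewrite ler_wpM2r ?ball0_vol_ge0//.
  rewrite -[leRHS]expr1 ler_wiXn2l//; [exact: ltW|by rewrite ge_min lexx].
apply: (@le_trans _ _ (eps / (V 1 + 1) * V 1)%R).
  by rewrite ler_wpM2r ?ball0_vol_ge0// ge_min lexx orbT.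
by rewrite mulrAC ler_pdivrMr// ler_pM2l// lerDl.
Qed.

Lemma ae_enorm_gt0 : {ae mu, forall x, (0 < enorm x)%R}.
Proof.
exists [set x | enorm x <= 0]%R; split.
- exact: measurable_enorm_le.
- exact: lebesgue_Rn_origin.
- by move=> x /= /negP; rewrite -leNgt.
Qed.

Lemma measurable_ball0_vol_enorm : measurable_fun setT w.
Proof.
rewrite (_ : w = (fun x => enorm x ^+ n * V 1)%R).
  apply: measurable_funM => //; apply: measurable_funX; exact: measurable_enorm.
by apply/funext => x; rewrite ball0_volE ?enorm_ge0.
Qed.

Lemma measurable_powR_ball0_vol (e : R) :
  measurable_fun setT (fun x : Rn R n => (w x `^ e)%:E).
Proof.
apply/measurable_EFinP.
apply: (measurableT_comp (measurable_powR e)); exact: measurable_ball0_vol_enorm.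
Qed.

Lemma ball0_vol_gt0 rho : (0 < V 1)%R -> (0 < rho)%R -> (0 < V rho)%R.
Proof. by move=> V1 r0; rewrite ball0_volE ?ltW// mulr_gt0// exprn_gt0. Qed.

Lemma le_ball0_vol rho sigma : (0 <= rho)%R -> (rho <= sigma)%R -> (V rho <= V sigma)%R.
Proof.
move=> r0 rs; rewrite (ball0_volE n_gt0 r0) (ball0_volE n_gt0 (le_trans r0 rs)).
by rewrite ler_wpM2r ?ball0_vol_ge0// lerXn2r// nnegrE (le_trans r0).
Qed.

(** A logarithmic scale for radii, divided by [n] so that the dimension disappears from the volume
    ratios. *)
Lemma ball0_volZ h rho : (0 <= rho)%R -> V (expR (h / n%:R) * rho) = (expR h * V rho)%R.
Proof.
move=> r0; rewrite ball0_volE ?mulr_ge0 ?expR_ge0// (ball0_volE n_gt0 r0).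
rewrite exprMn -expRM_natl.
by rewrite mulrCA mulfV ?mulr1 ?mulrA// pnatr_eq0 -lt0n.
Qed.

End radial_powers.

(** * Integrals of powers of the ball volume, by telescoping over shells *)

(** The right-hand side is the integral of [expR (e * t)] for [t] from 0 to [h], and the integrand
    is at least [expR (- (|e| * h))]. For either sign of [e] the inequality follows from
    [1 + t <= expR t]. *)
Lemma expR_increment_ge (R : realType) (e h : R) : (e != 0)%R -> (0 <= h)%R ->
  (h * expR (- (`|e| * h)) <= (expR (e * h) - 1) / e)%R.
Proof.
move=> e0 h0; have e0' : (0 < `|e|)%R by rewrite normr_gt0.
have [ep|en] := ltP 0%R e.
  rewrite (ger0_norm (ltW ep)) ler_pdivlMr//.
  apply: (@le_trans _ _ (h * e)%R).
    rewrite -mulrA ler_wpM2l// -[leRHS]mul1r (ler_wpM2r (ltW ep))//.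
    by rewrite -expR0 ler_expR oppr_le0 mulr_ge0// ltW.
  by have := expR_ge1Dx (e * h)%R; lra.
have {en}en : (e < 0)%R by rewrite lt_neqAle e0.
rewrite ltr0_norm// mulNr opprK ler_ndivlMr//.
have := expR_ge1Dx (- (e * h))%R => le1.
have : (expR (e * h) * (1 + - (e * h)) <= 1)%R.
  rewrite -[leRHS]expR0 -[X in (_ <= expR X)%R](subrr (e * h)%R) expRD.
  by rewrite ler_wpM2l// expR_ge0.
lra.
Qed.

Section radial_power_integrals.
Context (R : realType) (n : nat) (n_gt0 : (0 < n)%N).
Implicit Types (x : 'rV[R]_n) (rho sigma : R).
Local Notation mu := (@lebesgue_Rn R n).
Local Notation B := (@Defs.ball0 R n).
Local Notation V := (@ball0_vol R n).
Local Notation w := (fun x : Rn R n => V (enorm x)).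
Context (V1_gt0 : (0 < V 1)%R).

(* Consecutive radii [radius e rho k] multiply the volume by [expR (step e)],
   with [step e] so small that on one shell [w `^ (e - 1)] times the measure
   exceeds the increment of [V `^ e / e] at most by a factor 2. *)
Let step (e : R) : R := (ln 2 / (2 * `|e| + 2))%R.
Let radius (e rho : R) (z : R) : R := (expR (z * step e / n%:R) * rho)%R.

Let step_gt0 e : (0 < step e)%R.
Proof.
have ln2 : (0 < ln (2 : R))%R by rewrite ln_gt0 ?ltr1n.
by rewrite /step divr_gt0// ltr_wpDl ?mulr_ge0.
Qed.

Let radius_gt0 e rho z : (0 < rho)%R -> (0 < radius e rho z)%R.
Proof. by move=> rho0; rewrite mulr_gt0// expR_gt0. Qed.

Let le_radius e rho : (0 < rho)%R ->
  {homo radius e rho : y z / (y <= z)%R >-> (y <= z)%R}.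
Proof.
move=> rho0 y z yz; rewrite ler_pM2r// ler_expR ler_pM2r ?invr_gt0 ?ltr0n//.
by rewrite ler_pM2r// step_gt0.
Qed.

Let V_radius e rho z : (0 < rho)%R ->
  V (radius e rho z) = (expR (z * step e) * V rho)%R.
Proof. by move=> rho0; rewrite /radius ball0_volZ// ltW. Qed.

Let measurable_shell rho sigma : measurable (B sigma `\` B rho).
Proof. by apply: measurableD; exact: measurable_ball0. Qed.

Let mu_shell rho sigma : (0 < rho)%R -> (rho <= sigma)%R ->
  mu (B sigma `\` B rho) = (V sigma - V rho)%:E.
Proof.
move=> rho0 rs; have sigma0 := lt_le_trans rho0 rs.
rewrite measureD//; [|exact: measurable_ball0..|]; last first.
  by rewrite [X in X < _](mu_ball0 n sigma0) ltry.
rewrite setIC (@setIidl _ (B rho)); last first.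
  by move=> x; rewrite /Defs.ball0/= => /lt_le_trans; apply.
rewrite [X in X - _](mu_ball0 n sigma0) [X in _ - X](mu_ball0 n rho0).
by rewrite EFinB (ball0_volE n_gt0 (ltW rho0)) (ball0_volE n_gt0 (ltW sigma0)).
Qed.

(** With [a = V rho], on the shell [w] lies between [a] and [expR h * a], so the integrand is at
    most [a]^ (e - 1) * expR (|e - 1| * h)[, and the shell has measure]a * (expR h -
    1)[. Compared with the increment of]V [^ e / e], the loss is at most [expR] of [(|e - 1| + 1 +
    |e|) * h <= (2 * |e| + 2) * h = ln 2], which explains the choice of [step]. *)
Let integral_shell (e rho : R) : (e != 0)%R -> (0 < rho)%R ->
  \int[mu]_(x in B (radius e rho 1) `\` B rho) (w x `^ (e - 1))%:E <=
  (2 / e * (V (radius e rho 1) `^ e - V rho `^ e))%:E.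
Proof.
move=> e0 rho0; have h0 := step_gt0 e; set h := step e in h0 *.
have hE : ((2 * `|e| + 2) * h = ln 2)%R.
  by rewrite mulrC divfK// gt_eqF// ltr_wpDl ?mulr_ge0.
have a0 : (0 < V rho)%R by exact: ball0_vol_gt0.
set a := V rho in a0 *; have VE : V (radius e rho 1) = (expR h * a)%R.
  by rewrite V_radius// mul1r.
pose M := expR (`|e - 1| * h)%R.
apply: (@le_trans _ _ (\int[mu]_(x in B (radius e rho 1) `\` B rho)
    (a `^ (e - 1) * M)%:E)).
  apply: ge0_le_integral => //.
  - by move=> x _; rewrite lee_fin powR_ge0.
  - by apply: measurable_funTS; exact: measurable_powR_ball0_vol.
  move=> x []; rewrite /Defs.ball0/= => xr /negP; rewrite -leNgt => rx.
  have aw : (a <= w x)%R by rewrite le_ball0_vol// ltW.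
  have wa : (w x <= expR h * a)%R by rewrite -VE le_ball0_vol ?enorm_ge0// ltW.
  have w0 := lt_le_trans a0 aw.
  rewrite lee_fin /powR !gt_eqF// -expRD ler_expR.
  have : (ln a <= ln (w x))%R by rewrite ler_ln.
  have : (ln (w x) <= h + ln a)%R.
    by rewrite -[h]expRK -lnM ?posrE ?expR_gt0// ler_ln ?posrE ?mulr_gt0 ?expR_gt0.
  move=> le1 le2; rewrite -lerBlDl -mulrBr.
  apply: (@le_trans _ _ (`|e - 1| * (ln (w x) - ln a))%R).
    by rewrite ler_wpM2r ?subr_ge0// ler_norm.
  by rewrite ler_wpM2l//; lra.
have rr : (rho <= radius e rho 1)%R.
  apply: ler_peMl; first exact: ltW.
  by rewrite -[leLHS]expR0 ler_expR mul1r divr_ge0// (ltW h0).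
rewrite integral_cst// [X in _ * X](mu_shell rho0 rr) VE -EFinM lee_fin (powRM _ (expR_ge0 _) (ltW a0)).
have -> : (expR h `^ e = expR (e * h))%R.
  by rewrite /powR gt_eqF ?expR_gt0// expRK.
have -> : (a `^ e = a `^ (e - 1) * a)%R.
  rewrite -[X in (_ = _ * X)%R](powRr1 (ltW a0)) -powRD ?subrK//.
  by apply/implyP => _; rewrite gt_eqF.
rewrite -/a.
have -> : (a `^ (e - 1) * M * (expR h * a - a) = a `^ (e - 1) * a * (M * (expR h - 1)))%R by ring.
have -> : (2 / e * (expR (e * h) * (a `^ (e - 1) * a) - a `^ (e - 1) * a) =
  a `^ (e - 1) * a * (2 * ((expR (e * h) - 1) / e)))%R by field.
rewrite ler_wpM2l ?mulr_ge0 ?powR_ge0 ?(ltW a0)//.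
apply: (@le_trans _ _ (2 * (h * expR (- (`|e| * h))))%R); last first.
  by rewrite ler_wpM2l// expR_increment_ge// ltW.
have hexp : (expR h - 1 <= h * expR h)%R.
  have := expR_ge1Dx (- h)%R => le1.
  have : (expR h * (1 + - h) <= 1)%R.
    by rewrite -[leRHS]expR0 -[X in (_ <= expR X)%R](subrr h) expRD ler_wpM2l// expR_ge0.
  lra.
apply: (@le_trans _ _ (M * (h * expR h))%R); first by rewrite ler_wpM2l// expR_ge0.
rewrite mulrCA [leRHS]mulrCA (ler_wpM2l (ltW h0))//.
rewrite -[X in (_ <= X * _)%R]lnK ?posrE// -!expRD ler_expR -hE.
have : (`|e - 1| * h <= (`|e| + 1) * h)%R.
  by rewrite (ler_wpM2r (ltW h0))// (le_trans (ler_normB _ _))// normr1.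
lra.
Qed.

Let integral_shells (e rho : R) k : (e != 0)%R -> (0 < rho)%R ->
  \int[mu]_(x in B (radius e rho k%:R) `\` B rho) (w x `^ (e - 1))%:E <=
  (2 / e * (V (radius e rho k%:R) `^ e - V rho `^ e))%:E.
Proof.
move=> e0 rho0; elim: k => [|k ih].
  by rewrite /radius !mul0r expR0 mul1r setDv integral_set0 subrr mulr0.
set s := radius e rho k%:R in ih *; have s0 : (0 < s)%R by exact: radius_gt0.
have sE : radius e rho k.+1%:R = radius e s 1.
  by rewrite /s /radius -natr1 !mulrDl expRD mul1r mulrA [X in (X * _)%R]mulrC mulrA.
rewrite sE.
have rs : (rho <= s)%R.
  by rewrite -[leLHS](_ : radius e rho 0 = rho) ?le_radius// /radius !mul0r expR0 mul1r.
have ss : (s <= radius e s 1)%R.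
  by rewrite -[leLHS](_ : radius e s 0 = s) ?le_radius// /radius !mul0r expR0 mul1r.
have -> : B (radius e s 1) `\` B rho = (B (radius e s 1) `\` B s) `|` (B s `\` B rho).
  apply/seteqP; split => [x [xs xr]|x [[xs xr]|[xs xr]]].
  - by have [?|?] := pselect (B s x); [right|left].
  - split => // xr'; apply: xr; move: xr'; rewrite /Defs.ball0/= => /lt_le_trans; exact.
  - by split => //; move: xs; rewrite /Defs.ball0/= => /lt_le_trans; apply.
rewrite ge0_integral_setU//.
- apply: (le_trans (leeD (integral_shell e0 s0) ih)).
  rewrite -EFinD lee_fin; lra.
- by apply: measurable_funTS; exact: measurable_powR_ball0_vol.
- by move=> x _; rewrite lee_fin powR_ge0.
- by apply/disj_setPS => x [[_ ?] [? _]].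
Qed.


Let shell_rank (e rho y : R) : (0 < rho)%R ->
  exists k : nat, (y < radius e rho k%:R)%R.
Proof.
move=> rho0; pose d := (step e / n%:R)%R.
have d0 : (0 < d)%R by rewrite divr_gt0 ?step_gt0 ?ltr0n.
exists (Num.truncn (y / rho / d)).+1; set k := _.+1.
rewrite -ltr_pdivrMr//; apply: (@lt_trans _ _ (k%:R * d)%R).
  by rewrite -ltr_pdivrMr// truncnS_gt.
rewrite -mulrA -/d; have := expR_ge1Dx (k%:R * d)%R; lra.
Qed.

Let radius0 e rho : radius e rho 0 = rho.
Proof. by rewrite /radius !mul0r expR0 mul1r. Qed.

(** Telescoping already yields the factor [2 / - e]; stating 4 gives the same constant as for inner
    integrals, so that a single [C] serves the Schur test. *)
Lemma integral_powR_outer (e rho : R) : (e < 0)%R -> (0 < rho)%R ->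
  \int[mu]_(x in [set x | rho <= enorm x]%R) (w x `^ (e - 1))%:E <=
  (4 / - e * V rho `^ e)%:E.
Proof.
move=> e0 rho0; have Ne0 : (0 < - e)%R by rewrite oppr_gt0.
rewrite (_ : [set x | _]%R = \bigcup_k (B (radius e rho k%:R) `\` B rho)); last first.
  apply/seteqP; split => [x /= rx|x [k _ [_ /negP]]]; last by rewrite -leNgt.
  have [k xk] := shell_rank e (enorm x) rho0.
  by exists k => //; split => //; rewrite /Defs.ball0/= ltNge rx.
apply: ge0_integral_bigcup_le.
- move=> i j ij; apply/subsetPset => x [xi xr]; split => //.
  by apply: (lt_le_trans xi); apply: le_radius => //; rewrite ler_nat.
- by move=> k; exact: measurable_shell.
- exact: measurable_powR_ball0_vol.
- by move=> x; rewrite lee_fin powR_ge0.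
- move=> k; apply: (le_trans (integral_shells k (ltr0_neq0 e0) rho0)).
  rewrite lee_fin; set p := (V _ `^ e)%R; set q := (V rho `^ e)%R.
  have p0 : (0 <= p)%R by exact: powR_ge0.
  have q0 : (0 <= q)%R by exact: powR_ge0.
  rewrite -subr_ge0 (_ : _ - _ = (2 * q + 2 * p) / - e)%R; last first.
    by field; rewrite lt_eqF.
  by rewrite divr_ge0// ?(ltW Ne0)// addr_ge0// mulr_ge0.
Qed.

Let integral_powR_ball0 (e sigma : R) : (0 < e)%R -> (0 < sigma)%R ->
  \int[mu]_(x in B sigma) (w x `^ (e - 1))%:E <= (2 / e * V sigma `^ e)%:E.
Proof.
move=> e0 sigma0.
(* Shells with inner radii shrinking to 0 exhaust the ball except for the origin, a null set. *)
have -> : B sigma = (\bigcup_k (B sigma `\` B (radius e sigma (- k%:R)%R))) `|`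
    (B sigma `&` [set x | enorm x <= 0]%R).
  apply/seteqP; split => [x xs|x [[k _ [//]]|[//]]].
  have [x0|x0] := leP (enorm x) 0%R; [by right|left].
  have [k xk] := shell_rank e sigma x0.
  exists k => //; split => //; rewrite /Defs.ball0/=; apply/negP; rewrite -leNgt.
  rewrite /radius !mulNr expRN mulrC ler_pdivrMr ?expR_gt0// mulrC; exact/ltW.
have mf := @measurable_powR_ball0_vol R n n_gt0 (e - 1)%R.
have mU : measurable (\bigcup_k (B sigma `\` B (radius e sigma (- k%:R)%R))).
  by apply: bigcup_measurable => k _; exact: measurable_shell.
have mI : measurable (B sigma `&` [set x | enorm x <= 0]%R).
  by apply: measurableI; [exact: measurable_ball0|exact: measurable_enorm_le].
rewrite ge0_integral_setU//; first last.
- apply/disj_setPS => x [[k _ [_ xk]] [_ x0]]; apply: xk.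
  by rewrite /Defs.ball0/= (le_lt_trans x0)// radius_gt0.
- by move=> x _; rewrite lee_fin powR_ge0.
- exact: measurable_funTS.
rewrite [X in _ + X]null_set_integral//; last 2 first.
- exact: measurable_funTS.
- apply/eqP; rewrite eq_le measure_ge0 andbT -(@lebesgue_Rn_origin R n n_gt0).
  by apply: le_measure; rewrite ?inE//; exact: measurable_enorm_le.
rewrite adde0; apply: ge0_integral_bigcup_le => //.
- move=> i j ij; apply/subsetPset => x [xi xr]; split => // xj; apply: xr.
  by apply: (lt_le_trans xj); apply: le_radius => //; rewrite lerN2 ler_nat.
- by move=> x; rewrite lee_fin powR_ge0.
- move=> k; set rho := radius e sigma _.
  have rho0 : (0 < rho)%R by exact: radius_gt0.
  (* The annulus is read outwards, as [k] shells starting from its inner radius. *)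
  have -> : sigma = radius e rho k%:R.
    rewrite /rho /radius mulrA -expRD -!mulrDl.
    by rewrite addrN !mul0r expR0 mul1r.
  apply: (le_trans (integral_shells k (lt0r_neq0 e0) rho0)).
  rewrite lee_fin ler_wpM2l// ?divr_ge0 ?(ltW e0)//.
  by rewrite lerBlDr lerDl powR_ge0.
Qed.

Lemma integral_powR_inner (e rho : R) : (0 < e)%R -> (0 < rho)%R ->
  \int[mu]_(x in [set x | enorm x <= rho]%R) (w x `^ (e - 1))%:E <=
  (4 / e * V rho `^ e)%:E.
Proof.
move=> e0 rho0; set sigma := radius e rho 1.
have sigma0 : (0 < sigma)%R by exact: radius_gt0.
have rs : (rho < sigma)%R.
  rewrite /sigma -[ltLHS](radius0 e) ltr_pM2r// ltr_expR.
  by rewrite mul0r mul0r mul1r divr_gt0 ?step_gt0 ?ltr0n.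
apply: (@le_trans _ _ (\int[mu]_(x in B sigma) (w x `^ (e - 1))%:E)).
  apply: ge0_subset_integral.
  - exact: measurable_enorm_le.
  - exact: measurable_ball0.
  - by apply: measurable_funTS; exact: measurable_powR_ball0_vol.
  - by move=> x _; rewrite lee_fin powR_ge0.
  - by move=> x /= /le_lt_trans; apply.
apply: (le_trans (integral_powR_ball0 e0 sigma0)); rewrite lee_fin.
rewrite V_radius// mul1r powRM ?expR_ge0 ?ball0_vol_ge0//.
rewrite (_ : 4 / e = 2 / e * 2)%R; last by field; rewrite gt_eqF.
rewrite -[leRHS]mulrA ler_wpM2l// ?divr_ge0 ?(ltW e0)//.
rewrite ler_wpM2r ?powR_ge0// /powR gt_eqF ?expR_gt0// expRK.
rewrite -[leRHS]lnK ?posrE// ler_expR /step mulrA ler_pdivrMr; last first.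
  by rewrite ltr_wpDl// mulr_ge0.
rewrite [leLHS]mulrC ler_wpM2l//; last by rewrite gtr0_norm//; lra.
by rewrite ln_ge0// ler1n.
Qed.

End radial_power_integrals.

(** * Comparison of integrals and Hoelder's inequality on a set *)

Section integral_comparison.
Context d (T : measurableType d) (R : realType) (mu : {measure set T -> \bar R}).
Implicit Types (A D : set T) (f g : T -> R).

Lemma le_poweR (r : R) (x y : \bar R) :
  (0 <= r)%R -> 0 <= x -> x <= y -> x `^ r <= y `^ r.
Proof.
move=> r0 x0 xy; apply: gt0_ler_poweR => //.
- by rewrite in_itv/= x0 leey.
- by rewrite in_itv/= (le_trans x0)// leey.
Qed.

(* [ge0_le_integral] and [ae_ge0_le_integral] ask both functions to be
   measurable; only the larger one needs to be. *)
Lemma ge0_le_integralT (f1 f2 : T -> \bar R) :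
  (forall x, 0 <= f1 x) -> (forall x, f1 x <= f2 x) ->
  \int[mu]_x f1 x <= \int[mu]_x f2 x.
Proof.
move=> f10 f12; rewrite !ge0_integralTE//; last first.
  by move=> x; exact: le_trans (f12 x).
apply: ge_ereal_sup => _ [h /= hf1 <-]; apply: ereal_sup_ubound.
by exists h => //= x; exact: le_trans (f12 x).
Qed.

Lemma ae_ge0_le_integralT (f1 f2 : T -> \bar R) :
  (forall x, 0 <= f1 x) -> (forall x, 0 <= f2 x) -> measurable_fun setT f2 ->
  {ae mu, forall x, f1 x <= f2 x} -> \int[mu]_x f1 x <= \int[mu]_x f2 x.
Proof.
move=> f10 f20 mf2 [N [mN N0 f12]].
(* Raising [f2] to infinity on the null set [N] makes the inequality hold everywhere and leaves the
   integral unchanged. *)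
pose f3 := fun x => if x \in N then +oo else f2 x.
apply: (@le_trans _ _ (\int[mu]_x f3 x)).
  apply: ge0_le_integralT => // x; rewrite /f3; case: ifPn => [_|]; first exact: leey.
  move=> /negP xN; apply: contrapT => nle; apply: xN; rewrite inE; exact: f12.
rewrite le_eqVlt; apply/orP; left; apply/eqP; apply: ge0_ae_eq_integral => //.
- apply: measurable_fun_ifT => //.
  by apply: (measurable_fun_bool true); rewrite setTI preimage_mem_true.
- by move=> x _; rewrite /f3; case: ifP.
- exists N; split => // x /= xN; apply: contrapT => nN; apply: xN => _.
  by rewrite /f3; case: ifPn => //; rewrite inE.
Qed.

Lemma integral_EFin_indic A f :
  \int[mu]_(x in A) (f x)%:E = \int[mu]_x (f x * \1_A x)%:E.
Proof.
rewrite integral_mkcond; apply: eq_integral => x _; rewrite patchE indicE.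
by case: ifPn => _; rewrite ?mulr1 ?mulr0.
Qed.

Lemma hoelder_integral A f g (p q : R) : measurable A ->
  measurable_fun setT f -> measurable_fun setT g ->
  (forall x, (0 <= f x)%R) -> (forall x, (0 <= g x)%R) ->
  (0 < p)%R -> (0 < q)%R -> (p^-1 + q^-1 = 1)%R ->
  \int[mu]_(x in A) (f x * g x)%:E <=
  (\int[mu]_(x in A) (f x `^ p)%:E) `^ p^-1 *
  (\int[mu]_(x in A) (g x `^ q)%:E) `^ q^-1.
Proof.
move=> mA mf mg f0 g0 p0 q0 pq.
have mI : measurable_fun setT (\1_A : T -> R) by exact: measurable_indic.
(* The indicator of [A] can go into both factors because it equals its square. *)
have := hoelder mu (measurable_funM mf mI) (measurable_funM mg mI) p0 q0 pq.
rewrite Lnorm1 unlock /Lnorm !(integral_EFin_indic A).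
under eq_integral => x _.
  rewrite /= ger0_norm; last by rewrite !mulr_ge0// indicE ler0n.
  rewrite mulrACA -[(\1_A x * _)%R]expr2 (_ : \1_A x ^+ 2 = \1_A x)%R; last first.
    by rewrite indicE; case: (_ \in _); rewrite ?expr1n ?expr0n.
  over.
move=> /le_trans; apply; apply: lee_pmul; rewrite ?poweR_ge0//.
- rewrite le_eqVlt; apply/orP; left; apply/eqP; congr (_ `^ _).
  apply: eq_integral => x _ /=; rewrite indicE.
  by case: (_ \in _); rewrite ?mulr1 ?mulr0 ?normr0 ?powR0 ?gt_eqF// ger0_norm.
- rewrite le_eqVlt; apply/orP; left; apply/eqP; congr (_ `^ _).
  apply: eq_integral => x _ /=; rewrite indicE.
  by case: (_ \in _); rewrite ?mulr1 ?mulr0 ?normr0 ?powR0 ?gt_eqF// ger0_norm.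
Qed.

End integral_comparison.

(** * The Schur test for kernels that are powers of a weight, restricted to a set of pairs *)

Section weighted_schur_test.
Context d (T : measurableType d) (R : realType).
Context (mu : {sigma_finite_measure set T -> \bar R}).
Context (v g : T -> R) (E : set (T * T)) (alpha gamma p C : R).
Context (mv : measurable_fun setT v) (mg : measurable_fun setT g).
Context (mE : measurable E) (v0 : forall x, (0 <= v x)%R).
Context (g0 : forall x, (0 <= g x)%R) (p1 : (1 < p)%R) (C0 : (0 < C)%R).
Context (aev : {ae mu, forall x, (0 < v x)%R}) (alpha1 : alpha != 1%R).
(** In terms of the measure [dx / v x] and the function [v]^ (gamma / p) * g[, the kernel becomes](v
    x / v y) [^ theta] on [E]. The two hypotheses that follow bound its marginals by [C]. *)
Let theta := (alpha - gamma / p)%R.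
Context (H1 : forall y, (0 < v y)%R ->
  \int[mu]_(x in [set x | E (x, y)]) (v x `^ (theta - 1))%:E <=
  (C * v y `^ theta)%:E).
Context (H2 : forall x, (0 < v x)%R ->
  \int[mu]_(y in [set y | E (x, y)]) (v y `^ (- theta - 1))%:E <=
  (C * v x `^ (- theta))%:E).

Let p0 : (0 < p)%R. Proof. exact: lt_trans ltr01 p1. Qed.

Let mvX e : measurable_fun setT (fun x => v x `^ e)%R.
Proof. exact: (measurableT_comp (measurable_powR e)). Qed.

Let mgX e : measurable_fun setT (fun x => g x `^ e)%R.
Proof. exact: (measurableT_comp (measurable_powR e)). Qed.

Let mEx x : measurable [set y | E (x, y)].
Proof.
rewrite [X in measurable X](_ : _ = xsection E x); first exact: measurable_xsection.
by apply/seteqP; split => y /=; rewrite /xsection/= inE.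
Qed.

Let mEy y : measurable [set x | E (x, y)].
Proof.
rewrite [X in measurable X](_ : _ = ysection E y); first exact: measurable_ysection.
by apply/seteqP; split => x /=; rewrite /ysection/= inE.
Qed.

Let L y := \int[mu]_(x in [set x | E (x, y)])
  (v x `^ (theta + gamma - 1) * g x `^ p)%:E.

Let L_ge0 y : 0 <= L y.
Proof. by apply: integral_ge0 => x _; rewrite lee_fin mulr_ge0 ?powR_ge0. Qed.

(* Hoelder after splitting off [v `^ (gamma / (p q))], [q] the exponent
   conjugate to [p]; this is the choice for which both [H1] and [H2] enter
   with the same [theta]. *)
Let kernel_hoelder y : (0 < v y)%R ->
  \int[mu]_(x in [set x | E (x, y)]) (v x `^ (alpha - 1) * g x)%:E <=
  L y `^ p^-1 * ((C * v y `^ theta) `^ (1 - p^-1))%:E.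
Proof.
move=> vy.
pose delta := ((theta - 1) * (1 - p^-1))%R.
have q0 : (0 < (1 - p^-1)^-1)%R by rewrite invr_gt0 subr_gt0 invf_lt1.
pose f1 := (fun x => v x `^ (alpha - 1 - delta) * g x)%R.
pose f2 := (fun x => v x `^ delta)%R.
have mf1 : measurable_fun setT f1 by exact: measurable_funM.
have mf2 : measurable_fun setT f2 by exact: mvX.
apply: (@le_trans _ _ (\int[mu]_(x in [set x | E (x, y)]) (f1 x * f2 x)%:E)).
  apply: ge0_le_integral => //.
  - by move=> x _; rewrite lee_fin mulr_ge0 ?powR_ge0.
  - by apply/measurable_EFinP/measurable_funTS/measurable_funM.
  - by apply/measurable_EFinP/measurable_funTS/measurable_funM.
  move=> x _; rewrite lee_fin /f1 /f2 mulrAC ler_wpM2r//.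
  have := v0 x; rewrite le_eqVlt => /predU1P[<-|vx].
    (* Where [v x = 0] the left side vanishes, since 0 to the nonzero power [alpha - 1] is 0. *)
    by rewrite powR0 ?subr_eq0// mulr_ge0 ?powR_ge0.
  by rewrite -powRD ?subrK//; apply/implyP => _; rewrite gt_eqF.
have f10 x : (0 <= f1 x)%R by rewrite mulr_ge0 ?powR_ge0.
have f20 x : (0 <= f2 x)%R by rewrite powR_ge0.
have pq : (p^-1 + (1 - p^-1)^-1^-1 = 1)%R by rewrite invrK subrKC.
apply: (le_trans (hoelder_integral mu (mEy y) mf1 mf2 f10 f20 p0 q0 pq)).
rewrite invrK; apply: lee_pmul; [exact: poweR_ge0|exact: poweR_ge0| |].
- apply: le_poweR; first by rewrite invr_ge0 ltW.
    by apply: integral_ge0 => x _; rewrite lee_fin powR_ge0.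
  rewrite le_eqVlt; apply/orP; left; apply/eqP/eq_integral => x _.
  rewrite /f1 powRM ?powR_ge0// -powRrM; congr (_ `^ _ * _)%:E.
  by rewrite /delta /theta; field; rewrite gt_eqF.
- rewrite -poweR_EFin; apply: le_poweR; first by rewrite subr_ge0 invf_le1// ltW.
    by apply: integral_ge0 => x _; rewrite lee_fin powR_ge0.
  apply: le_trans (H1 vy); rewrite le_eqVlt; apply/orP; left; apply/eqP/eq_integral => x _.
  rewrite /f2 -powRrM; congr (_ `^ _)%:E; rewrite /delta; field.
  by rewrite (gt_eqF p0) /= subr_eq0 (gt_eqF p1).
Qed.

(** The powers of [v y] combine to [gamma - 1 - alpha * p + theta * (p - 1) = - theta - 1], because
    [gamma - alpha * p = - theta * p]. *)
Let pointwise y : (0 < v y)%R ->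
  (v y `^ (gamma - 1))%:E * (((v y `^ alpha)^-1)%:E *
     \int[mu]_(x in [set x | E (x, y)]) (v x `^ (alpha - 1) * g x)%:E) `^ p <=
  (C `^ (p - 1) * v y `^ (- theta - 1))%:E * L y.
Proof.
move=> vy; set K := ((C * v y `^ theta) `^ (1 - p^-1))%R.
have K0 : (0 <= K)%R by exact: powR_ge0.
have i0 : (0 <= (v y `^ alpha)^-1)%R by rewrite invr_ge0 powR_ge0.
apply: (@le_trans _ _ ((v y `^ (gamma - 1))%:E *
   (((v y `^ alpha)^-1)%:E * (L y `^ p^-1 * K%:E)) `^ p)).
  rewrite lee_wpmul2l// ?lee_fin ?powR_ge0//; apply: le_poweR; first exact: ltW.
    rewrite mule_ge0 ?lee_fin//; apply: integral_ge0 => x _.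
    by rewrite lee_fin mulr_ge0 ?powR_ge0.
  by rewrite lee_wpmul2l// ?lee_fin//; exact: kernel_hoelder.
rewrite poweRM ?lee_fin// ?mule_ge0 ?poweR_ge0//.
rewrite poweRM ?lee_fin// ?poweR_ge0// -poweRrM mulVf ?gt_eqF// poweRe1//.
rewrite [_ `^ p * _]muleC [L y * _]muleC [leLHS]muleC -!muleA.
rewrite [L y * _]muleC !muleA !poweR_EFin -!EFinM.
rewrite lee_wpmul2r// lee_fin /K.
rewrite -powRrM -powRN -powRrM mulrBl mulVf ?gt_eqF// mul1r.
rewrite powRM ?powR_ge0 ?(ltW C0)// -powRrM.
rewrite -!mulrA ler_wpM2l ?powR_ge0//.
have vD (a b : R) : (v y `^ a * v y `^ b = v y `^ (a + b))%R.
  by rewrite powRD//; apply/implyP => _; rewrite gt_eqF.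
rewrite !vD le_eqVlt; apply/orP; left; apply/eqP; congr (_ `^ _)%R.
by rewrite /theta; field; rewrite gt_eqF.
Qed.

(** After [pointwise], Tonelli exchanges the integrals; [H2] then contributes the last factor [C]
    and the power [v x]^ (- theta)[, which leaves]v x [^ (gamma - 1)]. [F] stands for the commutator
    integrand, hence is only nonnegative and dominated almost everywhere. *)
Lemma weighted_schur_test (F : T -> \bar R) : (forall y, 0 <= F y) ->
  {ae mu, forall y, F y <= (v y `^ (gamma - 1))%:E * (((v y `^ alpha)^-1)%:E *
     \int[mu]_(x in [set x | E (x, y)]) (v x `^ (alpha - 1) * g x)%:E) `^ p} ->
  \int[mu]_y F y <= (C `^ p)%:E * \int[mu]_x (v x `^ (gamma - 1) * g x `^ p)%:E.
Proof.
move=> F0 aeF.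
(* Here the pair is [(y, x)], with the outer variable in front, while [E] consists of pairs
   [(x, y)]. *)
pose k (z : T * T) := (v z.1 `^ (- theta - 1) *
  (v z.2 `^ (theta + gamma - 1) * g z.2 `^ p) * \1_E (z.2, z.1))%R.
have k0 z : (0 <= k z)%R by rewrite !mulr_ge0 ?powR_ge0// indicE ler0n.
have mk : measurable_fun setT k.
  apply: measurable_funM.
    apply: measurable_funM; first exact: (measurableT_comp (mvX _) measurable_fst).
    apply: measurable_funM; first exact: (measurableT_comp (mvX _) measurable_snd).
    exact: (measurableT_comp (mgX _) measurable_snd).
  have mI : measurable_fun setT (\1_E : T * T -> R) by exact: measurable_indic.
  have := measurableT_comp mI (@measurable_swap _ _ T T).
  exact.
have mk' : measurable_fun setT (EFin \o k) by exact/measurable_EFinP.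
have kL y : (v y `^ (- theta - 1))%:E * L y = \int[mu]_x (k (y, x))%:E.
  rewrite /L (integral_EFin_indic mu [set x | E (x, y)]) -ge0_integralZl//.
  - apply: eq_integral => x _; rewrite /k/= -EFinM mulrA !indicE.
    have -> : (x \in [set x | E (x, y)]) = ((x, y) \in E) by apply/idP/idP; rewrite !inE.
    by rewrite !mulrA.
  - apply/measurable_EFinP/measurable_funM; first exact: measurable_funM.
    exact: measurable_indic.
  - by move=> x _; rewrite lee_fin !mulr_ge0 ?powR_ge0// indicE ler0n.
  - by rewrite lee_fin powR_ge0.
have mI : measurable_fun setT (fun y => \int[mu]_x (k (y, x))%:E).
  by apply: (measurable_fun_fubini_tonelli_F _ mk') => z; rewrite lee_fin.
apply: (@le_trans _ _ (\int[mu]_y ((C `^ (p - 1))%:E * \int[mu]_x (k (y, x))%:E))).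
  apply: ae_ge0_le_integralT.
  - exact: F0.
  - move=> y; rewrite mule_ge0 ?lee_fin ?powR_ge0//.
    by apply: integral_ge0 => x _; rewrite lee_fin.
  - exact: measurable_funeM.
  - apply: filterS2 aeF aev => y /le_trans Fy /pointwise /Fy /le_trans; apply.
    by rewrite -kL muleA -EFinM.
rewrite ge0_integralZl//; last 2 first.
- by move=> y _; apply: integral_ge0 => x _; rewrite lee_fin.
- by rewrite lee_fin powR_ge0.
have -> : (C `^ p = C `^ (p - 1) * C)%R.
  by rewrite mulrC mulr_powRB1// ltW.
rewrite EFinM -muleA lee_wpmul2l ?lee_fin ?powR_ge0//.
have mw : measurable_fun setT (fun x => (v x `^ (gamma - 1) * g x `^ p)%:E).
  by apply/measurable_EFinP/measurable_funM.
rewrite (fubini_tonelli (fun z => (k z)%:E))// -ge0_integralZl//; last 2 first.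
- by move=> x _; rewrite lee_fin mulr_ge0 ?powR_ge0.
- by rewrite lee_fin ltW.
apply: ae_ge0_le_integralT.
- by move=> x; apply: integral_ge0 => y _; rewrite lee_fin.
- by move=> x; rewrite mule_ge0 ?lee_fin ?(ltW C0)// mulr_ge0 ?powR_ge0.
- exact: measurable_funeM.
apply: filterS aev => x vx.
pose c := (v x `^ (theta + gamma - 1) * g x `^ p)%R.
have c0 : (0 <= c)%R by rewrite mulr_ge0 ?powR_ge0.
have -> : \int[mu]_y (k (y, x))%:E =
    c%:E * \int[mu]_(y in [set y | E (x, y)]) (v y `^ (- theta - 1))%:E.
  rewrite (integral_EFin_indic mu [set y | E (x, y)]) -ge0_integralZl//.
  - apply: eq_integral => y _; rewrite /k/= -EFinM !mulrA [(c * _)%R]mulrC !indicE.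
    have -> : (y \in [set y | E (x, y)]) = ((x, y) \in E) by apply/idP/idP; rewrite !inE.
    by rewrite /c !mulrA.
  - by apply/measurable_EFinP/measurable_funM => //; exact: measurable_indic.
  - by move=> y _; rewrite lee_fin !mulr_ge0 ?powR_ge0// indicE ler0n.
apply: (le_trans (lee_wpmul2l _ (H2 vx))); first by rewrite lee_fin.
rewrite -!EFinM lee_fin mulrCA ler_wpM2l ?(ltW C0)// /c mulrAC ler_wpM2r ?powR_ge0//.
rewrite -powRD; last by apply/implyP => _; rewrite gt_eqF.
by rewrite le_eqVlt; apply/orP; left; apply/eqP; congr (_ `^ _)%R; ring.
Qed.

End weighted_schur_test.

(** * The essential bound on the oscillation of a CMO function *)

Lemma le0_geometric_bound (R : realType) (a M q : R) :
  (0 <= q < 1)%R -> (forall k : nat, (a <= M * q ^+ k)%R) -> (a <= 0)%R.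
Proof.
move=> /andP[q0 q1] aM; rewrite leNgt; apply/negP => a0.
have M0 : (0 < M)%R by have := aM 0%N; rewrite expr0 mulr1; exact: lt_le_trans.
have qq : (`|q| < 1)%R by rewrite ger0_norm.
have e0 : (0 < a / M)%R by rewrite divr_gt0.
have /cvgrPdist_lt /(_ _ e0)[k _ /(_ k (leqnn k))] := cvg_expr qq.
rewrite sub0r normrN ger0_norm ?exprn_ge0// ltr_pdivlMr// mulrC => /lt_le_trans.
by move=> /(_ _ (aM k)); rewrite ltxx.
Qed.

Section CMO_oscillation.
Context (R : realType) (n : nat) (n_gt0 : (0 < n)%N) (b : 'rV[R]_n -> R).
Context (mb : lebesgue_measurable_fun b) (bfin : CMO_norm b < +oo).
Local Notation mu := (@lebesgue_Rn R n).
Local Notation B := (@Defs.ball0 R n).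
Local Notation V := (@ball0_vol R n).
Context (V1_gt0 : (0 < V 1)%R).

Lemma CMO_norm_ge0 : 0 <= CMO_norm b.
Proof.
apply: (@le_trans _ _ (CMO_pnorm 1 b)).
  apply: le_trans (poweR_ge0 _ _) _; last first.
    by apply: ereal_sup_ubound; exists 1%R => //=; exact: ltr01.
by apply: ereal_sup_ubound; exists 1%R => //=; exact: lexx.
Qed.

Let N := fine (CMO_norm b).

Let N_ge0 : (0 <= N)%R. Proof. by rewrite fine_ge0// CMO_norm_ge0. Qed.

Let NE : CMO_norm b = N%:E.
Proof. by rewrite /N fineK// ge0_fin_numE// CMO_norm_ge0. Qed.

Let osc (rho : R) x := (`|b x - ball0_mean b rho|)%R.

Let mosc rho : measurable_fun setT (osc rho : Rn R n -> R).
Proof.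
by apply: measurableT_comp => //; apply: measurable_funB => //; exact: mb.
Qed.

Let mA rho t : measurable ([set x | B rho x /\ t <= osc rho x]%R : set (Rn R n)).
Proof.
rewrite [X in measurable X](_ : _ =
    B rho `&` (setT `&` (osc rho : Rn R n -> R) @^-1` `[t, +oo[)).
  apply: measurableI; first exact: measurable_ball0.
  by apply: mosc => //; exact: measurable_itv.
by rewrite setTI; apply/seteqP; split => x /=; rewrite in_itv/= andbT.
Qed.

(* Chebyshev for every power [k]; the supremum over all exponents in the CMO
   norm turns the decay in [k] into an essential bound. *)
Let mu_osc_gt rho t : (0 < rho)%R -> (N < t)%R ->
  mu [set x | B rho x /\ t <= osc rho x]%R = 0.
Proof.
move=> rho0 Nt; set A := [set x | _]; have t0 := le_lt_trans N_ge0 Nt.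
have Vrho : (0 < V rho)%R by exact: ball0_vol_gt0.
have Afin : mu A \is a fin_num.
  rewrite ge0_fin_numE//; apply: (@le_lt_trans _ _ (mu (B rho))).
    by apply: le_measure; rewrite ?inE; [exact: mA|exact: measurable_ball0|move=> x []].
  by rewrite mu_ball0// ltry.
have := fineK Afin; set a := fine (mu A) => aE.
suff : (a <= 0)%R.
  by move=> a0; rewrite -aE; congr EFin; apply/eqP; rewrite eq_le a0 fine_ge0.
(* Chebyshev is used with exponent [k + 1], since the norm ranges over exponents at least 1; the
   extra factor [N / t] goes into the constant. *)
apply: (@le0_geometric_bound _ _ (V rho * (N / t))%R (N / t)%R).
  by rewrite divr_ge0 ?(ltW t0)//= ltr_pdivrMr// mul1r.
move=> k; rewrite -mulrA -exprS; set p : R := k.+1%:R.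
have p1 : (1 <= p)%R by rewrite ler1n.
have p0 : (0 < p)%R by rewrite ltr0n.
pose I := \int[mu]_(x in B rho) (osc rho x `^ p)%:E.
have I0 : 0 <= I by apply: integral_ge0 => x _; rewrite lee_fin powR_ge0.
have IN : (V rho)^-1%:E * I <= (N `^ p)%:E.
  have : ((V rho)^-1%:E * I) `^ p^-1 <= N%:E.
    rewrite -NE; apply: (@le_trans _ _ (CMO_pnorm p b)); apply: ereal_sup_ubound.
      by exists rho.
    by exists p.
  move=> /(le_poweR (ltW p0) (poweR_ge0 _ _)).
  by rewrite -poweRrM mulVf ?gt_eqF// poweRe1// mule_ge0// lee_fin invr_ge0 ltW.
have AI : (t `^ p)%:E * mu A <= I.
  apply: (@le_trans _ _ (\int[mu]_(x in A) (osc rho x `^ p)%:E)); last first.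
    apply: ge0_subset_integral => //.
    - exact: mA.
    - exact: measurable_ball0.
    - apply/measurable_EFinP/measurable_funTS.
      exact: (measurableT_comp (measurable_powR p) (mosc rho)).
    - by move=> x _; rewrite lee_fin powR_ge0.
    - by move=> x [].
  rewrite -integral_cst; last exact: mA.
  apply: ge0_le_integral => //.
  - exact: mA.
  - by move=> x _; rewrite lee_fin powR_ge0.
  - apply/measurable_EFinP/measurable_funTS.
    exact: (measurableT_comp (measurable_powR p) (mosc rho)).
  - move=> x [_ tx]; rewrite lee_fin; apply: ge0_ler_powR; rewrite ?nnegrE//.
    + exact: ltW.
    + exact: normr_ge0.
have : (t `^ p)%:E * mu A <= (V rho * N `^ p)%:E.
  apply: (le_trans AI); rewrite EFinM -lee_pdivrMl//.
rewrite -aE -EFinM lee_fin !powR_mulrn ?(ltW t0)// => ta.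
by rewrite expr_div_n mulrA ler_pdivlMr ?exprn_gt0// mulrC.
Qed.

(** Balls of integer radius and thresholds [N + 1 / (j + 1)] suffice, so one countable union of null
    sets serves all pairs. Two points outside it lie in a common such ball, and comparing both
    values with its mean costs the factor 2. *)
Lemma CMO_ae_oscillation : exists Z : set (Rn R n),
  [/\ measurable Z, mu Z = 0 &
  forall x y, ~ Z x -> ~ Z y -> (`|b x - b y| <= 2 * fine (CMO_norm b))%R].
Proof.
pose S i j : set (Rn R n) :=
  [set x | B i.+1%:R x /\ N + j.+1%:R^-1 <= osc i.+1%:R x]%R.
have S0 i j : mu (S i j) = 0.
  by apply: mu_osc_gt => //; rewrite ltrDl invr_gt0.
have mS i j : measurable (S i j) by exact: mA.
have mU i : measurable (\bigcup_j S i j).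
  by apply: bigcup_measurable => j _; exact: mS.
have mUU : measurable (\bigcup_i \bigcup_j S i j).
  by apply: bigcup_measurable => i _; exact: mU.
exists (\bigcup_i \bigcup_j S i j); split => //.
- apply/(@negligibleP _ _ _ mu) => //.
  apply: negligible_bigcup => i; apply: negligible_bigcup => j.
  by apply/(@negligibleP _ _ _ mu); [exact: mS|exact: S0].
move=> x y xZ yZ; pose i := Num.truncn (Num.max (enorm x) (enorm y)).
have bound z : ~ (\bigcup_i \bigcup_j S i j) z ->
    (enorm z <= Num.max (enorm x) (enorm y))%R -> (osc i.+1%:R z <= N)%R.
  move=> zZ zi; apply/ler_addgt0Pr => e e0; rewrite leNgt; apply/negP => osce.
  apply: zZ; exists i => //; exists (Num.truncn e^-1) => //; split.
    by rewrite /Defs.ball0/= (le_lt_trans zi)// truncnS_gt.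
  rewrite (le_trans _ (ltW osce))// lerD2l -[leRHS]invrK lef_pV2 ?posrE ?invr_gt0//.
  exact/ltW/truncnS_gt.
have := bound x xZ; rewrite le_max lexx => /(_ isT).
have := bound y yZ; rewrite le_max lexx orbT => /(_ isT).
rewrite /osc -/N; set m := ball0_mean _ _ => ym xm.
rewrite (_ : b x - b y = (b x - m) - (b y - m))%R; last by ring.
by rewrite (le_trans (ler_normB _ _))// mulr2n mulrDl mul1r lerD.
Qed.

End CMO_oscillation.

(** * The constant, and the reduction of both commutators to the Schur test *)

Lemma c2_ge (R : realType) (n : nat) (r s alpha gamma theta : R) :
  (0 < r)%R -> (0 < s)%R -> (0 < `|1 - gamma * r / s|)%R ->
  (`|1 - gamma * r / s| <= theta)%R ->
  ((4 / theta * 2 `^ r) `^ (s / r))%:E <= c2 n r s alpha gamma.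
Proof.
move=> r0 s0 d0 dtheta; have t0 := lt_le_trans d0 dtheta.
have p0 : (0 <= s / r)%R by rewrite divr_ge0 ?ltW.
have two (x : R) : (0 <= x)%R -> (1 <= 2 `^ x)%R.
  by move=> x0; rewrite -[leLHS](powRr0 2) ler_powR// ler1n.
(* The term [k = 1] of the series already gives more than [4 * 2 `^ r]. *)
rewrite /c2; set d := (`|_|)%R; set S := \sum_(0 <= k <oo) _.
set q := (n%:R * `|alpha - 1|)%R.
set c := (X in X%:E * S).
have c0 : (0 <= c)%R by rewrite !mulr_ge0 ?powR_ge0.
have S1 : (2 `^ (- q))%:E <= S.
  have : \sum_(0 <= k < 2) (2 `^ (- (k%:R * n%:R * `|alpha - 1|)) * k%:R `^ r)%:E <= S.
    by apply: nneseries_lim_ge => k _; rewrite lee_fin mulr_ge0 ?powR_ge0.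
  rewrite !big_nat_recl//= big_nil adde0.
  by rewrite powR0 ?gt_eqF// mulr0 add0e powR1 mulr1 mul1r -/q.
have le1 : (4 * 2 `^ r)%:E <= c%:E * S.
  apply: (@le_trans _ _ (c * 2 `^ (- q))%:E); last first.
    by rewrite EFinM lee_wpmul2l// lee_fin.
  have q1 : (2 `^ q * 2 `^ (- q) = 1 :> R)%R.
    by rewrite powRN mulfV// gt_eqF// powR_gt0.
  have -> : (c * 2 `^ (- q) = 2 `^ (n%:R * `|alpha|) * 3 `^ r * 4 *
      2 `^ (2 * n%:R * r) * (2 `^ q * 2 `^ (- q)))%R by rewrite /c -/q; ring.
  rewrite q1 mulr1 lee_fin.
  have h1 : (1 <= 2 `^ (n%:R * `|alpha|) :> R)%R by apply: two; rewrite mulr_ge0.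
  have h2 : (1 <= 2 `^ (2 * n%:R * r) :> R)%R by apply: two; rewrite !mulr_ge0// ltW.
  have h3 : (2 `^ r <= 3 `^ r :> R)%R.
    by rewrite ge0_ler_powR ?(ltW r0)// ?nnegrE// ler_nat.
  have h4 : (0 <= 2 `^ r :> R)%R by exact: powR_ge0.
  apply: (@le_trans _ _ (1 * 3 `^ r * 4 * 1)%R); first lra.
  apply: ler_pM => //.
  by rewrite ler_wpM2r// ler_wpM2r// powR_ge0.
apply: (@le_trans _ _ ((d `^ (s / r))^-1%:E * ((4 * 2 `^ r)%:E `^ (s / r)))).
  rewrite poweR_EFin -EFinM lee_fin -powRN.
  have -> : (d `^ (- (s / r)) = d^-1 `^ (s / r))%R.
    by rewrite -(powR_inv1 (ltW d0)) -powRrM mulN1r.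
  rewrite -powRM ?invr_ge0 ?(ltW d0)// ?mulr_ge0 ?powR_ge0//.
  have i0 : (0 <= theta^-1)%R by rewrite invr_ge0 ltW.
  have j0 : (0 <= d^-1)%R by rewrite invr_ge0 ltW.
  apply: ge0_ler_powR => //; rewrite ?nnegrE ?mulr_ge0 ?powR_ge0//.
  rewrite [leRHS]mulrA [X in (_ <= X * _)%R]mulrC ler_wpM2r ?powR_ge0//.
  by rewrite ler_wpM2l// lef_pV2 ?posrE.
rewrite lee_wpmul2l// ?lee_fin ?invr_ge0 ?powR_ge0//.
by apply: le_poweR => //; rewrite lee_fin mulr_ge0 ?powR_ge0.
Qed.

HB.instance Definition _ (R : realType) (n : nat) := Measure_isSigmaFinite.Build
  _ _ _ (@lebesgue_Rn R n) (@sigma_finite_lebesgue_Rn R n).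

Section commutators.
Context (R : realType) (n : nat) (n_gt0 : (0 < n)%N) (b f : 'rV[R]_n -> R).
Context (mb : lebesgue_measurable_fun b) (bfin : CMO_norm b < +oo).
Context (mf : lebesgue_measurable_fun f).
Local Notation mu := (@lebesgue_Rn R n).
Local Notation V := (@ball0_vol R n).
Local Notation w := (fun x : Rn R n => V (enorm x)).
Context (V1_gt0 : (0 < V 1)%R) (r s alpha gamma : R).
Context (r0 : (0 < r)%R) (rs : (r < s)%R) (alpha1 : alpha != 1%R).
Context (E : set (Rn R n * Rn R n)) (mE : measurable E).

Let p := (s / r)%R.
Let theta := (alpha - gamma / p)%R.
Let C := (4 / `|theta|)%R.
Let N := fine (CMO_norm b).

Let mabsf : measurable_fun setT (fun x : Rn R n => `|f x|%R).
Proof. by apply: measurableT_comp => //; exact: mf. Qed.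

Let mbB c : measurable_fun setT (fun x : Rn R n => `|b x - b c|%R).
Proof.
have mbc : measurable_fun setT (fun x : Rn R n => b x - b c)%R.
  exact: (measurable_funB mb (measurable_cst _)).
exact: (measurableT_comp (@normr_measurable R setT) mbc).
Qed.

Lemma commutator_bound :
  (0 < `|1 - gamma * r / s|)%R -> (`|1 - gamma * r / s| <= `|theta|)%R ->
  (forall y, (0 < enorm y)%R ->
    \int[mu]_(x in [set x | E (x, y)]) (w x `^ (theta - 1))%:E <=
    (C * w y `^ theta)%:E) ->
  (forall x, (0 < enorm x)%R ->
    \int[mu]_(y in [set y | E (x, y)]) (w y `^ (- theta - 1))%:E <=
    (C * w x `^ (- theta))%:E) ->
  \int[mu]_y ((w y `^ (gamma - 1))%:E * ((((w y `^ alpha)^-1)%:E *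
     \int[mu]_(x in [set x | E (x, y)])
       (w x `^ (alpha - 1) * (`|b x - b y| * `|f x|) `^ r)%:E) `^ r^-1) `^ s) <=
  c2 n r s alpha gamma * CMO_norm b `^ s *
    \int[mu]_y (w y `^ (gamma - 1) * `|f y| `^ s)%:E.
Proof.
move=> d0 dt H1 H2; have t0 := lt_le_trans d0 dt.
have s0 : (0 < s)%R by exact: lt_trans rs.
have p1 : (1 < p)%R by rewrite ltr_pdivlMr// mul1r.
have p0 : (0 < p)%R by exact: lt_trans p1.
have rp : (r * p = s)%R by rewrite mulrC divfK// gt_eqF.
have C0 : (0 < C)%R by rewrite divr_gt0.
have w_enorm x : (0 < w x)%R -> (0 < enorm x)%R.
  rewrite !lt_neqAle enorm_ge0 eq_sym [(_ == enorm x)%R]eq_sym andbT => /andP[wx _].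
  apply: contra wx => /eqP ->; rewrite ball0_volE//.
  by rewrite expr0n eqn0Ngt n_gt0 mul0r.
have N0 : (0 <= N)%R by rewrite fine_ge0// CMO_norm_ge0.
have NE : CMO_norm b = N%:E by rewrite fineK// ge0_fin_numE// CMO_norm_ge0.
have ae_filter := @ae_filter_ringOfSetsType _ (Rn R n) R mu.
have [Z [mZ Z0 bZ]] := CMO_ae_oscillation n_gt0 mb bfin V1_gt0.
have aeZ : {ae mu, forall x, ~ Z x}.
  by exists Z; split => // x /= /contrapT.
pose g (x : Rn R n) := ((2 * N * `|f x|) `^ r)%R.
have g0 x : (0 <= g x)%R by exact: powR_ge0.
have mg : measurable_fun setT g.
  exact: (measurableT_comp (measurable_powR r) (measurable_funM (measurable_cst _) mabsf)).
have mw := @measurable_ball0_vol_enorm R n n_gt0.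
have aew : {ae mu, forall x, (0 < w x)%R}.
  apply: (@filterS _ _ ae_filter) (@ae_enorm_gt0 R n n_gt0) => x.
  exact: ball0_vol_gt0.
have mEy y : measurable [set x | E (x, y)].
  rewrite [X in measurable X](_ : _ = ysection E y); first exact: measurable_ysection.
  by apply/seteqP; split => x /=; rewrite /ysection/= inE.
apply: le_trans (@weighted_schur_test _ _ _ mu w g E alpha gamma p C mw mg mE
  (fun x => ball0_vol_ge0 _ _) g0 p1 C0 aew alpha1
  (fun y wy => H1 y (w_enorm y wy)) (fun x wx => H2 x (w_enorm x wx)) _ _ _) _.
- by move=> y; rewrite mule_ge0 ?poweR_ge0// lee_fin powR_ge0.
- clear H1 H2; apply: (@filterS _ _ ae_filter _ _ _ aeZ) => y yZ.
  rewrite -poweRrM (mulrC r^-1 s)%R -/p; apply: lee_wpmul2l.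
    by rewrite lee_fin powR_ge0.
  have i0 : (0 <= (w y `^ alpha)^-1)%R by rewrite invr_ge0 powR_ge0.
  apply: le_poweR; first exact: ltW.
    apply: mule_ge0; first by rewrite lee_fin.
    by apply: integral_ge0 => x _; rewrite lee_fin mulr_ge0 ?powR_ge0.
  apply: lee_wpmul2l; first by rewrite lee_fin.
  apply: ae_ge0_le_integral.
  + exact: mEy.
  + by move=> x _; rewrite lee_fin mulr_ge0 ?powR_ge0.
  + apply/measurable_EFinP/measurable_funTS; apply: measurable_funM.
      exact: (measurableT_comp (measurable_powR _) mw).
    exact: (measurableT_comp (measurable_powR r) (measurable_funM (mbB y) mabsf)).
  + by move=> x _; rewrite lee_fin mulr_ge0 ?powR_ge0.
  + apply/measurable_EFinP/measurable_funTS; apply: measurable_funM mg.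
    exact: (measurableT_comp (measurable_powR _) mw).
  apply: (@filterS _ _ ae_filter _ _ _ aeZ) => x xZ _; rewrite lee_fin ler_wpM2l ?powR_ge0//.
  apply: ge0_ler_powR; first exact: ltW.
  + by rewrite nnegrE mulr_ge0.
  + by rewrite nnegrE !mulr_ge0.
  + by apply: ler_wpM2r => //; exact: bZ.
have -> : \int[mu]_x (w x `^ (gamma - 1) * g x `^ p)%:E =
    ((2 * N) `^ s)%:E * \int[mu]_x (w x `^ (gamma - 1) * `|f x| `^ s)%:E.
  rewrite -ge0_integralZl; first last.
  - by rewrite lee_fin powR_ge0.
  - by move=> x _; rewrite lee_fin mulr_ge0 ?powR_ge0.
  - apply/measurable_EFinP/measurable_funM.
      exact: (measurableT_comp (measurable_powR _) mw).
    exact: (measurableT_comp (measurable_powR s) mabsf).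
  - exact: measurableT.
  - apply: eq_integral => x _; rewrite -EFinM /g -powRrM rp.
    by rewrite powRM ?mulr_ge0// mulrCA.
rewrite muleA lee_wpmul2r//.
  by apply: integral_ge0 => x _; rewrite lee_fin mulr_ge0 ?powR_ge0.
rewrite NE poweR_EFin powRM// EFinM muleA lee_wpmul2r ?lee_fin ?powR_ge0//.
(* Since [r * p = s], the constant [C]^ p * 2 [^ s] equals [(4 / |theta| * 2]^ r) [^ p]. *)
apply: le_trans (@c2_ge R n r s alpha gamma _ r0 s0 d0 dt).
rewrite -EFinM lee_fin [in leRHS]powRM ?powR_ge0 ?(ltW C0)//.
by rewrite -[in leRHS]powRrM -/p rp.
Qed.

End commutators.

Theorem theorem4 (R : realType) (n : nat) (r s alpha gamma : R)
    (b f : 'rV[R]_n -> R)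
    (n_ge1 : (1 <= n)%N) (r_gt0 : (0 < r)%R) (r_lt_s : (r < s)%R)
    (bCMO : CMO b)
    (fmeas : lebesgue_measurable_fun f) (fbnd : locally_bounded f)
    (fLr : loc_power_integrable r alpha f) :
  ((1 < alpha)%R -> (gamma < s / r)%R ->
    \int[@lebesgue_Rn R n]_y
       ((ball0_vol n (enorm y) `^ (gamma - 1))%:E * Mcomm r b f alpha y `^ s)
    <= c2 n r s alpha gamma * CMO_norm b `^ s *
       \int[@lebesgue_Rn R n]_y
         (ball0_vol n (enorm y) `^ (gamma - 1) * `|f y| `^ s)%:E)
  /\
  ((alpha < 1)%R -> (s / r < gamma)%R ->
    \int[@lebesgue_Rn R n]_y
       ((ball0_vol n (enorm y) `^ (gamma - 1))%:E * Mcomm_dual r b f alpha y `^ s)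
    <= c2 n r s alpha gamma * CMO_norm b `^ s *
       \int[@lebesgue_Rn R n]_y
         (ball0_vol n (enorm y) `^ (gamma - 1) * `|f y| `^ s)%:E).
Proof.
have [[mb _] bfin] := bCMO.
have s_gt0 : (0 < s)%R by exact: lt_trans r_lt_s.
have [V1|V1_le0] := ltP 0%R (ball0_vol n (1 : R)); last first.
  have V10 : ball0_vol n (1 : R) = 0%R.
    by apply/eqP; rewrite eq_le V1_le0 ball0_vol_ge0.
  suff trivial_case (F : Rn R n -> \bar R) : (forall y, 0 <= F y) ->
      \int[@lebesgue_Rn R n]_y F y <= c2 n r s alpha gamma * CMO_norm b `^ s *
       \int[@lebesgue_Rn R n]_y
         (ball0_vol n (enorm y) `^ (gamma - 1) * `|f y| `^ s)%:E.
    by split => _ _; apply: trivial_case => y;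
      rewrite mule_ge0 ?poweR_ge0// lee_fin powR_ge0.
  move=> F0; apply: (@le_trans _ _ 0).
    rewrite -(integral0 (@lebesgue_Rn R n) setT); apply: ae_ge0_le_integralT => //.
    by exists setT; split => //; exact: lebesgue_Rn_null.
  apply: mule_ge0; last by apply: integral_ge0 => x _; rewrite lee_fin mulr_ge0 ?powR_ge0.
  apply: mule_ge0; last exact: poweR_ge0.
  by rewrite /c2 mule_ge0 ?poweR_ge0// lee_fin invr_ge0 powR_ge0.
have gp : (gamma / (s / r) = gamma * r / s)%R by rewrite invf_div mulrA.
have menorm_lt : measurable [set z : Rn R n * Rn R n | enorm z.1 < enorm z.2]%R.
  rewrite [X in measurable X](_ : _ = setT `&`
      (fun z : Rn R n * Rn R n => enorm z.1 < enorm z.2)%R @^-1` [set true]).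
    apply: measurable_fun_ltr => //.
    - exact: (measurableT_comp (@measurable_enorm R n) measurable_fst).
    - exact: (measurableT_comp (@measurable_enorm R n) measurable_snd).
  by rewrite setTI; apply/seteqP; split => z.
split=> [alpha1 gamma_lt|alpha1 gamma_gt].
- have d0 : (0 < 1 - gamma * r / s)%R by rewrite subr_gt0 -gp ltr_pdivrMr ?divr_gt0// mul1r.
  (* From [alpha > 1] one gets [theta > 1 - gamma / p > 0], which also yields the comparison of
     absolute values. *)
  have t0 : (0 < alpha - gamma / (s / r))%R by rewrite gp; lra.
  apply: (@commutator_bound R n n_ge1 b f mb bfin fmeas V1 r s alpha gamma r_gt0 r_lt_s
    (negbT (gt_eqF alpha1)) [set z | enorm z.1 < enorm z.2]%R menorm_lt).
  + by rewrite gtr0_norm.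
  + by rewrite !gtr0_norm// gp; lra.
  + move=> y y0; rewrite gtr0_norm//.
    apply: le_trans (integral_powR_inner n_ge1 V1 t0 y0); apply: ge0_subset_integral.
    * exact: (@measurable_ball0 R n (enorm y)).
    * exact: measurable_enorm_le.
    * by apply: measurable_funTS; exact: measurable_powR_ball0_vol.
    * by move=> x _; rewrite lee_fin powR_ge0.
    * by move=> x /= /ltW.
  + move=> x x0; rewrite gtr0_norm//.
    have Nt0 : (- (alpha - gamma / (s / r)) < 0)%R by rewrite oppr_lt0.
    have := integral_powR_outer n_ge1 V1 Nt0 x0; rewrite opprK; apply: le_trans.
    apply: ge0_subset_integral.
    * rewrite (_ : [set y | _] = ~` [set y | enorm y <= enorm x]%R).
        exact/measurableC/measurable_enorm_le.
      by apply/seteqP; split => y /=; rewrite ltNge => /negP.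
    * exact: measurable_enorm_ge.
    * by apply: measurable_funTS; exact: measurable_powR_ball0_vol.
    * by move=> y _; rewrite lee_fin powR_ge0.
    * by move=> y /= /ltW.
- have d0 : (1 - gamma * r / s < 0)%R.
    by rewrite subr_lt0 -gp ltr_pdivlMr ?divr_gt0// mul1r.
  (* Now [theta < 1 - gamma / p < 0], so inner and outer integrals exchange roles. The complement of
     the strict relation has closed balls as sections in [y], to which the inner bound for closed
     balls applies. *)
  have t0 : (alpha - gamma / (s / r) < 0)%R by rewrite gp; lra.
  have Nt0 : (0 < - (alpha - gamma / (s / r)))%R by rewrite oppr_gt0.
  apply: (@commutator_bound R n n_ge1 b f mb bfin fmeas V1 r s alpha gamma r_gt0 r_lt_s
    (negbT (lt_eqF alpha1)) (~` [set z | enorm z.1 < enorm z.2]%R)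
    (measurableC menorm_lt)).
  + by rewrite ltr0_norm// oppr_gt0.
  + by rewrite !ltr0_norm// gp; lra.
  + move=> y y0; rewrite ltr0_norm//.
    rewrite (_ : [set x | _] = [set x | enorm y <= enorm x]%R).
      exact: integral_powR_outer.
    by apply/seteqP; split => x /=; rewrite leNgt => /negP.
  + move=> x x0; rewrite ltr0_norm//.
    rewrite (_ : [set y | _] = [set y | enorm y <= enorm x]%R).
      exact: integral_powR_inner.
    by apply/seteqP; split => y /=; rewrite leNgt => /negP.
Qed.
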